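(* Let $(X,d)$ be a compact metric space, let $f_1,f_2:X\to X$ be continuous maps, and let $F=\{f_1,f_2\}$ be the associated multiple mappings. Suppose there is a point $c\in X$ such that $f_1(x)=c$ for all $x\in X$ and $f_2(c)=c$. If $p\in X$ is a periodic point of $f_2$, then $p$ is a periodic point of $F$.
   Context: A point $x\in X$ is a periodic point of a map $f:X\to X$ if $f^n(x)=x$ for some integer $n\ge 1$. For $F=\{f_1,f_2\}$, an integer $n>0$ and $x\in X$, put $$F^n(x)=\{f_{i_1}f_{i_2}\cdots f_{i_n}(x)\mid i_1,\dots,i_n\in\{1,2\}\}\subset X,$$ where juxtaposition denotes composition; in particular $F(x)=F^1(x)=\{f_1(x),f_2(x)\}$. The deleted orbit of $x$ under $F$ is the set of subsets $\mathring{orb}(x,F)=\{F(x),F^2(x),F^3(x),\dots\}$. A point $x\in X$ is a periodic point of $F$ if $\mathring{orb}(x,F)$ is finite (as a set of subsets of $X$) and there exists an integer $m>0$ such that $x\in F^m(x)$. *)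

(* Defs.v *)
From mathcomp Require Import all_boot all_order all_algebra.
From mathcomp Require Import all_classical all_reals topology.

Set Implicit Arguments.
Unset Strict Implicit.
Unset Printing Implicit Defensive.

Local Open Scope classical_set_scope.

Definition periodic_point (X : Type) (f : X -> X) (x : X) : Prop :=
  exists2 n : nat, (0 < n)%N & iter n f x = x.

(** [F = {f1, f2}] as an indexed family: the index [0 : 'I_2] stands for 1 and
    [1 : 'I_2] for 2. *)
Definition multiple_mappings (X : Type) (f1 f2 : X -> X) : 'I_2 -> X -> X :=
  fun i => if i == ord0 then f1 else f2.

(** [foldr F x [:: i1; ...; in]] is [F i1 (F i2 (... (F in x)))]. *)
Definition multi_iter (X : Type) (F : 'I_2 -> X -> X) (n : nat) (x : X) :
    set X :=
  [set foldr F x w | w in [set: n.-tuple 'I_2]].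

Definition deleted_orbit (X : Type) (F : 'I_2 -> X -> X) (x : X) :
    set (set X) :=
  [set multi_iter F n x | n in [set n : nat | (0 < n)%N]].

Definition multi_periodic_point (X : Type) (F : 'I_2 -> X -> X) (x : X) :
    Prop :=
  finite_set (deleted_orbit F x) /\
  exists2 m : nat, (0 < m)%N & multi_iter F m x x.

(* Main.v *)
(** A word in [f1], [f2] that uses [f1] sends every point to [c], since both maps
    fix [c]. Hence [F^n(x) = {c, f2^n(x)}] for [n > 0], and this set depends only
    on [n] modulo the period when [x] is periodic for [f2]. *)

Require Import Defs.
From mathcomp Require Import all_boot all_order all_algebra.
From mathcomp Require Import all_classical all_reals topology.

Set Implicit Arguments.
Unset Strict Implicit.
Unset Printing Implicit Defensive.

Local Open Scope classical_set_scope.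

Lemma iter_modn_period (T : Type) (f : T -> T) (x : T) (N n : nat) :
  iter N f x = x -> iter (n %% N) f x = iter n f x.
Proof.
(* The full periods are put innermost, where they fix [x]; only the remainder is left to act. *)
move=> fNx; rewrite [in RHS](divn_eq n N) addnC iterD; congr iter.
by elim: (n %/ N) => // q IHq; rewrite mulSn iterD -IHq fNx.
Qed.

Lemma multi_iter_const (X : Type) (f1 f2 : X -> X) (c x : X) (n : nat) :
  (forall y, f1 y = c) -> f2 c = c -> (0 < n)%N ->
  multi_iter (multiple_mappings f1 f2) n x = [set c; iter n f2 x].
Proof.
move=> f1c f2c n_gt0; apply/seteqP; split=> [_ [[w w_n] _ <-] /=|y].
(* With [n] replaced by the length of [w], induction can start at the empty word, whose value is
   [x]. *)
- rewrite -(eqP w_n) {w_n}; elim: w => [|i w IHw] /=.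
    by right.
  rewrite [multiple_mappings _ _ i _]/multiple_mappings;
  case: ifP => _; first by left; rewrite f1c.
  by case: IHw => ->; [left | right]; rewrite ?f2c.
- have foldr_f2 k :
      foldr (multiple_mappings f1 f2) x (nseq k ord_max) = iter k f2 x.
    by elim: k => //= k ->.
  case=> ->; last by exists (nseq_tuple n ord_max); rewrite /= ?foldr_f2.
  (* Positive length leaves room for an outermost letter [f1], which yields [c] whatever follows. *)
  case: n n_gt0 => // n _.
  by exists (cons_tuple ord0 (nseq_tuple n ord_max)) => //=; apply: f1c.
Qed.

Theorem theorem3p5 (R : realType) (X : metricType R) (f1 f2 : X -> X) (c : X)
    (p : X) :
  compact [set: X] ->
  continuous f1 -> continuous f2 ->
  (forall x : X, f1 x = c) -> f2 c = c ->
  periodic_point f2 p ->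
  multi_periodic_point (multiple_mappings f1 f2) p.
Proof.
move=> _ _ _ f1c f2c [N N_gt0 f2Np]; split; last first.
  by exists N => //; rewrite (multi_iter_const _ f1c f2c)//; right.
(* Multiples of [N] are represented by [k = 0], which must give [[set c; p]]; the zeroth iterate of
   the family would give only the singleton of [p]. *)
apply: (@sub_finite_set _ _ [set [set c; iter k f2 p] | k in `I_N]).
  move=> _ [n n_gt0 <-]; exists (n %% N)%N; first by rewrite /= ltn_mod.
  by rewrite (multi_iter_const _ f1c f2c)// iter_modn_period.
exact/finite_image/finite_II.
Qed.
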